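(* Let $R$ be an Abelian exchange ring, let $p$ be a prime number and let $G$ be a group of order $p$. If $p\in J(R)$ (that is, $p\cdot 1_R\in J(R)$), then the group ring $RG$ is clean.
   Context: All rings are associative with identity, not necessarily commutative. For a ring $R$ and a group $G$, $RG$ denotes the group ring of $G$ over $R$, and $J(R)$ denotes the Jacobson radical of $R$. A ring is Abelian if all its idempotents are central. A ring $R$ is an exchange ring if for every $a\in R$ there is an idempotent $e\in aR$ with $1-e\in (1-a)R$ (equivalently, the module $R_R$ has the finite exchange property). An element of a ring is clean if it is the sum of a unit and an idempotent; a ring is clean if every element of it is clean. *)

(* Defs.v *)
From HB Require Import structures.
From mathcomp Require Import all_boot all_algebra all_fingroup.
From mathcomp Require Import classical_sets.

Set Implicit Arguments.
Unset Strict Implicit.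
Unset Printing Implicit Defensive.

Import GRing.Theory.
Local Open Scope classical_set_scope.
Local Open Scope ring_scope.

Section RingNotions.
Variable R : pzRingType.
Implicit Types (a e u x : R) (I M : set R).

Definition idempotent_elt e := e * e = e.

(* GRing.unit is available only on a unitRingType, which carries a chosen
   inverse; an arbitrary ring has none. *)
Definition unit_elt u := exists v : R, u * v = 1 /\ v * u = 1.

Definition abelian_ring := forall e, idempotent_elt e -> forall x, e * x = x * e.

Definition exchange_ring :=
  forall a, exists e, [/\ idempotent_elt e,
    exists r : R, e = a * r & exists s : R, 1 - e = (1 - a) * s].

Definition clean_elt a :=
  exists u e : R, [/\ unit_elt u, idempotent_elt e & a = u + e].

Definition clean_ring := forall a, clean_elt a.

Definition right_ideal I :=
  [/\ I 0, forall x y : R, I x -> I y -> I (x + y)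
    & forall x r : R, I x -> I (x * r)].

Definition maximal_right_ideal M :=
  [/\ right_ideal M, ~ M 1
    & forall I, right_ideal I -> M `<=` I -> ~ I 1 -> I = M].

Definition jacobson_radical : set R :=
  [set x | forall M, maximal_right_ideal M -> M x].

End RingNotions.

Arguments abelian_ring : clear implicits.
Arguments exchange_ring : clear implicits.
Arguments clean_ring : clear implicits.
Arguments jacobson_radical : clear implicits.

(* The ring R[G]: f stands for the formal sum of the f(g) g over g in G.
   A separate name is needed because {ffun G -> R} already carries the pointwise
   product; only its additive group structure is reused here. *)
Definition group_ring (R : pzRingType) (G : finGroupType) : Type :=
  {ffun G -> R}.

Section GroupRing.
Variables (R : pzRingType) (G : finGroupType).

HB.instance Definition _ :=
  GRing.Zmodule.copy (group_ring R G) {ffun G -> R}.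

Implicit Types a b c : {ffun G -> R}.

Definition group_ring_one : {ffun G -> R} := [ffun g => (g == 1%g)%:R].

(* (\sum_h a_h h) * (\sum_k b_k k) collected at g = h * k, k = h^-1 * g. *)
Definition group_ring_mul a b : {ffun G -> R} :=
  [ffun g => \sum_(h : G) a h * b (h^-1 * g)%g].

Lemma group_ring_mulA : associative group_ring_mul.
Proof.
move=> a b c; apply/ffunP => g; rewrite !ffunE.
under eq_bigr => h _ do rewrite ffunE mulr_sumr.
under [RHS]eq_bigr => k _ do rewrite ffunE mulr_suml.
rewrite [RHS]exchange_big /=; apply: eq_bigr => h _.
rewrite [RHS](reindex_inj (mulgI h)) /=; apply: eq_bigr => k _.
by rewrite mulrA mulKg invMg mulgA.
Qed.

Lemma group_ring_mul1r : left_id group_ring_one group_ring_mul.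
Proof.
move=> a; apply/ffunP => g; rewrite ffunE (bigD1 1%g) //= big1 ?addr0.
  by rewrite ffunE eqxx mul1r invg1 mul1g.
by move=> h /negPf h1; rewrite ffunE h1 mul0r.
Qed.

Lemma group_ring_mulr1 : right_id group_ring_one group_ring_mul.
Proof.
move=> a; apply/ffunP => g; rewrite ffunE (bigD1 g) //= big1 ?addr0.
  by rewrite ffunE mulVg eqxx mulr1.
by move=> h /negPf hg; rewrite ffunE -eq_mulVg1 hg mulr0.
Qed.

Lemma group_ring_mulDl : left_distributive group_ring_mul +%R.
Proof.
move=> a b c; apply/ffunP => g; rewrite !ffunE -big_split /=.
by apply: eq_bigr => h _; rewrite ffunE mulrDl.
Qed.

Lemma group_ring_mulDr : right_distributive group_ring_mul +%R.
Proof.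
move=> a b c; apply/ffunP => g; rewrite !ffunE -big_split /=.
by apply: eq_bigr => h _; rewrite ffunE mulrDr.
Qed.

HB.instance Definition _ := GRing.Zmodule_isPzRing.Build (group_ring R G)
  group_ring_mulA group_ring_mul1r group_ring_mulr1
  group_ring_mulDl group_ring_mulDr.

End GroupRing.

(* Main.v *)
Require Import Defs.
From mathcomp Require Import all_boot all_algebra all_fingroup.
From mathcomp Require Import classical_sets.
From mathcomp Require Import boolp cyclic.

(** The augmentation [aug : RG -> R], which adds up the coefficients, is a
    surjective ring morphism split by the constants.  Two facts give the result.

    First, [R] itself is clean ([abelian_exchange_clean]): if [e = a r] and
    [1 - e = (1 - a) s], then [r e - s (1 - e)] is a right inverse of
    [a - (1 - e)], and in an Abelian ring one-sided inverses are two-sided.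

    Second, units lift along the augmentation ([unit_of_aug]).  Let [g] generate
    [G].  Then [c = g - 1] is central, it generates the augmentation ideal, and
    expanding [1 = (c + 1) ^ p] shows that [c ^ p] is a multiple of [p].  So an
    element [y] of augmentation 1, being [1 - c w] for some [w], divides
    [1 - c ^ p w ^ p] on the left, and the right ideal [y RG] is the whole of
    [RG] modulo [p].  As [p] lies in the Jacobson radical of [R] and [RG] is
    finitely generated over [R], Nakayama's lemma ([group_ring_nakayama]) gives
    [y RG = RG].

    Now for [x] in [RG] write [aug x = u + e] with [u] a unit and [e] idempotent;
    then [x - e] has augmentation [u], so it is a unit, and [x = (x - e) + e]. *)

Set Implicit Arguments.
Unset Strict Implicit.
Unset Printing Implicit Defensive.

Import GRing.Theory.
Local Open Scope classical_set_scope.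
Local Open Scope ring_scope.

(** * Abelian exchange rings are clean *)

(** [v u] is idempotent, hence central, so [v u = (v u) (u v) = u (v u) v = 1]. *)
Lemma abelian_dedekind_finite (R : pzRingType) (u v : R) :
  abelian_ring R -> u * v = 1 -> v * u = 1.
Proof.
move=> abR uv1.
have id_vu : idempotent_elt (v * u).
  by rewrite /idempotent_elt mulrA -(mulrA v u v) uv1 mulr1.
have := abR _ id_vu u.
rewrite mulrA uv1 mul1r => vuu.
by rewrite -[LHS]mulr1 -uv1 mulrA vuu.
Qed.

Lemma abelian_exchange_clean (R : pzRingType) :
  abelian_ring R -> exchange_ring R -> clean_ring R.
Proof.
move=> abR exR a; have [e [ide [r er] [s]]] := exR a.
set f := 1 - e => fs.
have fe : f * e = 0 by rewrite mulrBl mul1r ide subrr.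
have idf : idempotent_elt f by rewrite /idempotent_elt mulrBr mulr1 fe subr0.
exists (a - f), f; split=> //; last by rewrite subrK.
have inv : (a - f) * (r * e - s * f) = 1.
  have fre : f * (r * e) = 0 by rewrite -(abR _ ide) mulrA fe mul0r.
  have fsf : f * (s * f) = s * f by rewrite mulrA (abR _ idf) -mulrA idf.
  rewrite mulrBr mulrBl fre subr0 mulrA -er ide mulrBl fsf.
  by rewrite opprB -[X in X - a * _]mul1r -mulrBl mulrA -fs idf addrC subrK.
exists (r * e - s * f); split=> //; exact: abelian_dedekind_finite.
Qed.

(** * The Jacobson radical *)

(** Zorn's lemma is applied to the sets closed under the ideal operations that
    avoid 1 and contain [a] as soon as they have an element: this last clause,
    instead of membership of [a], lets the empty chain have a bound. *)
Lemma proper_principal_sub_maximal (R : pzRingType) (a : R) :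
  (forall v, a * v <> 1) -> exists2 M, maximal_right_ideal M & M a.
Proof.
move=> aN1.
pose P (A : set R) := [/\ forall x y, A x -> A y -> A (x + y),
  forall x r, A x -> A (x * r), ~ A 1 & forall x, A x -> A a].
have [F FP Ftot|A [PA maxA]] := @Zorn_bigcup R P.
  split.
  - move=> x y [A FA Ax] [B FB By].
    case: (Ftot A B FA FB) => sub.
    + by exists B => //; case: (FP _ FB) => + _ _ _; apply=> //; apply: sub.
    + by exists A => //; case: (FP _ FA) => + _ _ _; apply=> //; apply: sub.
  - by move=> x r [A FA Ax]; exists A => //; case: (FP _ FA) => _ + _ _; apply.
  - by case=> A FA A1; case: (FP _ FA).
  - by move=> x [A FA Ax]; exists A => //; case: (FP _ FA) => _ _ _; apply; exact: Ax.
have Aa : A a.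
  pose I : set R := [set x | exists r, x = a * r].
  have Ia : I a by exists 1; rewrite mulr1.
  apply: contrapT => NAa.
  have NA x : ~ A x by case: PA => _ _ _ PAa /PAa.
  apply: (maxA I); first by split=> [x /NA|/(_ _ Ia)].
  split=> //.
  - by move=> _ _ [r ->] [s ->]; exists (r + s); rewrite mulrDr.
  - by move=> _ s [r ->]; exists (r * s); rewrite mulrA.
  - by case=> r /esym /aN1.
case: PA => AD AM A1 _; exists A => //; split=> //.
  by split=> //; rewrite -(mulr0 a); apply: AM.
move=> I [I0 ID IM] AI I1; apply: contrapT => neqIA.
apply: (maxA I); last by split=> // x _; apply: AI.
by split=> // IA; apply: neqIA; apply/seteqP; split.
Qed.

(** Otherwise [1 - x r] would lie in a maximal right ideal, together with [x r],
    hence with 1. *)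
Lemma jacobson_right_invertible (R : pzRingType) (x : R) :
  jacobson_radical R x -> forall r, exists v, (1 - x * r) * v = 1.
Proof.
move=> Jx r; apply: contrapT => Nv.
have [|M maxM Mxr] := @proper_principal_sub_maximal R (1 - x * r).
  by move=> v xv; apply: Nv; exists v.
have [[_ MD MM] M1 _] := maxM.
by apply: M1; rewrite -(subrK (x * r) 1); exact: MD Mxr (MM _ _ (Jx _ maxM)).
Qed.

(** * Monomials and augmentation in a group ring *)

Section GroupRingTheory.
Variables (R : pzRingType) (G : finGroupType).
Local Notation RG := (group_ring R G).
Implicit Types (x y z d : RG) (r s : R) (g h k : G).

Definition coef x g : R := (x : {ffun G -> R}) g.

Definition monom r h : RG := [ffun g => if g == h then r else 0] : {ffun G -> R}.

Definition aug x : R := \sum_g coef x g.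

Lemma group_ringP x y : coef x =1 coef y -> x = y.
Proof. by move=> eqxy; apply/ffunP. Qed.

Lemma coefD x y g : coef (x + y) g = coef x g + coef y g.
Proof. exact: ffunE. Qed.

Lemma coefB x y g : coef (x - y) g = coef x g - coef y g.
Proof. by rewrite /coef !ffunE. Qed.

Lemma coefMn x n g : coef (x *+ n) g = coef x g *+ n.
Proof.
elim: n => [|n IH]; first by rewrite !mulr0n /coef ffunE.
by rewrite !mulrS coefD IH.
Qed.

Lemma coefM x y g : coef (x * y) g = \sum_h coef x h * coef y (h^-1 * g)%g.
Proof. exact: ffunE. Qed.

Lemma coef_sum (I : finType) (F : I -> RG) g :
  coef (\sum_i F i) g = \sum_i coef (F i) g.
Proof. by rewrite /coef sum_ffunE. Qed.

Lemma coef_monom r h g : coef (monom r h) g = if g == h then r else 0.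
Proof. exact: ffunE. Qed.

Lemma monomB r s h : monom (r - s) h = monom r h - monom s h.
Proof.
apply: group_ringP => g; rewrite coefB !coef_monom.
by case: eqP; rewrite ?subr0.
Qed.

Lemma monomMn r n h : monom (r *+ n) h = monom r h *+ n.
Proof.
by apply: group_ringP => g; rewrite coefMn !coef_monom; case: eqP; rewrite ?mul0rn.
Qed.

Lemma monom1 : monom 1 1%g = 1 :> RG.
Proof. by apply: group_ringP => g; rewrite coef_monom /coef ffunE; case: eqP. Qed.

Lemma monomM r s h k : monom r h * monom s k = monom (r * s) (h * k)%g.
Proof.
apply: group_ringP => g; rewrite coefM coef_monom (bigD1 h) //= big1 => [|i /negPf ih].
  rewrite addr0 !coef_monom eqxx (can2_eq (mulKVg h) (mulKg h)).
  by case: eqP; rewrite ?mulr0.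
by rewrite coef_monom ih mul0r.
Qed.

Lemma monomX h n : monom 1 h ^+ n = monom 1 (h ^+ n)%g.
Proof.
elim: n => [|n IH]; first by rewrite expr0 expg0 monom1.
by rewrite exprS IH monomM mul1r expgS.
Qed.

Lemma coef_mulr_monom1 x r g : coef (x * monom r 1%g) g = coef x g * r.
Proof.
rewrite coefM (bigD1 g) //= big1 => [|h /negPf hg].
  by rewrite addr0 mulVg coef_monom eqxx.
by rewrite coef_monom -eq_mulVg1 hg mulr0.
Qed.

Lemma sum_monom x : x = \sum_h monom (coef x h) h.
Proof.
apply: group_ringP => g; rewrite coef_sum (bigD1 g) //= big1 => [|h /negPf hg].
  by rewrite coef_monom eqxx addr0.
by rewrite coef_monom eq_sym hg.
Qed.

Lemma augB x y : aug (x - y) = aug x - aug y.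
Proof. by rewrite /aug -sumrB; apply: eq_bigr => g _; rewrite coefB. Qed.

Lemma aug_monom r h : aug (monom r h) = r.
Proof.
rewrite /aug (bigD1 h) //= big1 => [|g /negPf gh]; first by rewrite coef_monom eqxx addr0.
by rewrite coef_monom gh.
Qed.

Lemma aug1 : aug 1 = 1.
Proof. by rewrite -monom1 aug_monom. Qed.

Lemma augM x y : aug (x * y) = aug x * aug y.
Proof.
rewrite /aug mulr_suml; under eq_bigr => g _ do rewrite coefM.
rewrite exchange_big /=; apply: eq_bigr => h _.
rewrite (reindex_inj (mulgI h)) mulr_sumr /=.
by apply: eq_bigr => k _; rewrite mulKg.
Qed.

(** * Nakayama's lemma *)

(** The free module [RG] has the elements of [G] as a basis.  The monomials needed
    to correct members of [N] are eliminated one at a time: if [h] is still needed,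
    the representation of [h] itself reads [h (1 - p r) = n + p z'] with [z'] free
    of [h], and [1 - p r] is right invertible. *)
Lemma group_ring_nakayama (p : nat) (N : set RG) :
  (forall r, exists v, (1 - r *+ p) * v = 1) -> right_ideal N ->
  (forall x, exists2 n, N n & exists z, x = n + z *+ p) -> N 1.
Proof.
move=> invp [N0 ND NM] cover.
suff elim_supp (S : seq G) :
    (forall x, exists2 n, N n & exists2 z, (forall g, g \notin S -> coef z g = 0)
       & x = n + z *+ p) -> N 1.
  apply: (elim_supp (enum G)) => x; have [n Nn [z ->]] := cover x.
  by exists n => //; exists z => // g; rewrite mem_enum.
elim: S => [|h S IH] cover_hS.
  have [n Nn [z z0 ->]] := cover_hS 1.
  suff -> : z = 0 by rewrite mul0rn addr0.
  by apply: group_ringP => g; rewrite z0 // /coef ffunE.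
apply: IH => x.
pose off_h z : RG := z - monom (coef z h) h.
have off_hS z : (forall g, g \notin h :: S -> coef z g = 0) ->
    forall g, g \notin S -> coef (off_h z) g = 0.
  move=> z0 g gS; rewrite coefB coef_monom; case: eqP => [->|/eqP gh].
    by rewrite subrr.
  by rewrite z0 ?subr0 // inE negb_or gh.
have [n0 Nn0 [z0 supp0 eq0]] := cover_hS (monom 1 h).
have [n Nn [z suppz ->]] := cover_hS x.
have [v inv_v] := invp (coef z0 h).
(* Dividing by [1 - p r] with [r = coef z0 h]: now [h] is expressed without [h]. *)
have eqh : monom 1 h = n0 * monom v 1%g + (off_h z0 * monom v 1%g) *+ p.
  rewrite -[in LHS]inv_v -[X in monom _ X](mulg1 h) -monomM monomB monomMn eq0.
  by rewrite -mulrnAl -mulrDl mulrnBl addrA.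
pose t := coef z h.
have eqz : z = n0 * monom v 1%g * monom t 1%g
             + ((off_h z0 * monom v 1%g * monom t 1%g) *+ p + off_h z).
  rewrite -mulrnAl addrA -mulrDl -eqh monomM mul1r mulg1.
  by rewrite /off_h addrC subrK.
exists (n + n0 * monom v 1%g * monom t 1%g * p%:R).
  exact: ND Nn (NM _ _ (NM _ _ (NM _ _ Nn0))).
exists ((off_h z0 * monom v 1%g * monom t 1%g) *+ p + off_h z).
  move=> g gS; rewrite coefD coefMn !coef_mulr_monom1 !off_hS //.
  by rewrite !mul0r mul0rn add0r.
by rewrite mulr_natr -addrA -mulrnDl -eqz.
Qed.

(** * Lifting units along the augmentation *)

(** The binomial expansion of [1 = (c + 1) ^ p] has all its middle terms divisible
    by [p]; keeping [c + 1] rather than expanding [(g - 1) ^ p] avoids the sign of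
    [(-1) ^ p]. *)
Lemma prime_exp_unity_sub1 (A : pzRingType) (p : nat) (c : A) :
  prime p -> (c + 1) ^+ p = 1 -> exists q, c ^+ p = q *+ p.
Proof.
case: p => // n p_prime; rewrite exprDn_comm; last exact: commr1.
rewrite big_ord_recl big_ord_recr /= /bump /= !add1n.
rewrite subn0 subnn bin0 binn !expr1n expr0 !mulr1 !mulr1n addrA => /eqP.
rewrite -subr_eq0 addrK addr_eq0 => /eqP ->.
apply: (big_ind (fun S => exists q, - S = q *+ n.+1)).
- by exists 0; rewrite mul0rn oppr0.
- by move=> S S' [q eq_q] [q' eq_q']; exists (q + q'); rewrite opprD eq_q eq_q' mulrnDl.
- move=> i _; rewrite add1n.
  have /dvdnP [m ->] : (n.+1 %| 'C(n.+1, i.+1))%N.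
    by apply: prime_dvd_bin => //=; rewrite ltnS ltn_ord.
  by rewrite mulrnA -mulNrn; eexists.
Qed.

Lemma monom_central g : (forall h, commute g h) -> forall x, GRing.comm (monom 1 g) x.
Proof.
move=> cg x; rewrite [x]sum_monom /GRing.comm mulr_sumr mulr_suml.
by apply: eq_bigr => h _; rewrite !monomM mul1r mulr1 cg.
Qed.

(** Subtracting [aug d = 0] turns [d] into a combination of the [g ^ i - 1], each
    a multiple of [g - 1]. *)
Lemma aug0_generator g d : (forall h, h \in <[g]>)%g ->
  aug d = 0 -> exists w, d = (monom 1 g - 1) * w.
Proof.
move=> gen d0.
have -> : d = \sum_h (monom (coef d h) h - monom (coef d h) 1%g).
  rewrite sumrB -sum_monom; suff -> : \sum_h monom (coef d h) 1%g = 0 by rewrite subr0.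
  apply: group_ringP => k; rewrite coef_sum; under eq_bigr do rewrite coef_monom.
  by case: eqP => _; rewrite ?[LHS]d0 ?big1 // /coef ffunE.
elim/big_ind: _ => [|_ _ [w ->] [w' ->]|h _]; first by exists 0; rewrite mulr0.
  by exists (w + w'); rewrite mulrDr.
have /cycleP [i def_h] := gen h.
exists ((\sum_(j < i) monom 1 g ^+ j) * monom (coef d h) 1%g).
by rewrite mulrA -subrX1 mulrBl mul1r monomX monomM mul1r mulg1 -def_h.
Qed.

Lemma aug0_exp_prime (p : nat) d : prime p -> #|G| = p ->
  aug d = 0 -> exists q, d ^+ p = q *+ p.
Proof.
move=> pp cardG d0.
have cardT : #|[set: G]%G| = p by rewrite cardsT.
have cycT : cyclic [set: G]%G by apply: prime_cyclic; rewrite cardT.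
have /cyclicP [g genT] := cycT.
have gen h : (h \in <[g]>)%g by rewrite -genT inE.
have cg h : commute g h by apply: (centsP (cyclic_abelian cycT)); rewrite inE.
have [w ->] := aug0_generator gen d0.
have [|q eq_q] := @prime_exp_unity_sub1 _ p (monom 1 g - 1 : RG) pp.
  by rewrite subrK monomX -cardT expg_cardG ?inE // monom1.
exists (q * w ^+ p); rewrite exprMn_comm ?eq_q ?mulrnAl //.
apply/commr_sym/commrB; last exact: commr1.
exact/commr_sym/monom_central.
Qed.

Section UnitLifting.
Variable p : nat.
Hypotheses (p_prime : prime p) (cardG : #|G| = p)
  (invp : forall r, exists v, (1 - r *+ p) * v = 1).

(** With [d = 1 - y], the product of [y] and [1 + d + ... + d ^ (p - 1)] is
    [1 - d ^ p], which is 1 modulo [p]. *)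
Lemma right_invertible_aug1 y : aug y = 1 -> exists z, y * z = 1.
Proof.
move=> y1; pose d := 1 - y.
have [|q eq_q] := @aug0_exp_prime p d p_prime cardG.
  by rewrite augB aug1 y1 subrr.
pose s := \sum_(i < p) d ^+ i.
have ys : y * s = 1 - q *+ p.
  have -> : y = - (d - 1) by rewrite opprB subKr.
  by rewrite mulNr -subrX1 opprB eq_q.
pose N : set RG := [set x | exists z, x = y * z].
suff [z ->] : N 1 by exists z.
apply: (group_ring_nakayama invp) => [|x].
  split; first by exists 0; rewrite mulr0.
    by move=> _ _ [z ->] [z' ->]; exists (z + z'); rewrite mulrDr.
  by move=> _ r [z ->]; exists (z * r); rewrite mulrA.
exists (y * (s * x)); first by exists (s * x).
by exists (q * x); rewrite mulrA ys mulrBl mul1r mulrnAl subrK.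
Qed.

Lemma right_invertible_of_aug y : unit_elt (aug y) -> exists z, y * z = 1.
Proof.
case=> v [uv _]; have [|z yz] := @right_invertible_aug1 (y * monom v 1%g).
  by rewrite augM aug_monom.
by exists (monom v 1%g * z); rewrite mulrA.
Qed.

(** A right inverse of [y] has a unit augmentation too, so it is itself right
    invertible, and its right inverse can only be [y]. *)
Lemma unit_of_aug y : unit_elt (aug y) -> unit_elt y.
Proof.
move=> uy; have [z yz] := right_invertible_of_aug uy.
have [v [uv vu]] := uy.
have augz : aug z = v.
  by rewrite -[LHS]mul1r -vu -mulrA -augM yz aug1 mulr1.
have [|w zw] := @right_invertible_of_aug z; first by exists (aug y); rewrite augz.
have yw : y = w by rewrite -[LHS]mulr1 -zw mulrA yz mul1r.
by exists z; split=> //; rewrite yw.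
Qed.

Lemma group_ring_clean : clean_ring R -> clean_ring RG.
Proof.
move=> clR x; have [u [e [uu ide eqx]]] := clR (aug x).
exists (x - monom e 1%g), (monom e 1%g); split; last by rewrite subrK.
  by apply: unit_of_aug; rewrite augB aug_monom eqx addrK.
by rewrite /idempotent_elt monomM mulg1 ide.
Qed.

End UnitLifting.
End GroupRingTheory.

Theorem theorem5 (R : pzRingType) (p : nat) (G : finGroupType) :
  abelian_ring R -> exchange_ring R ->
  prime p -> #|G| = p ->
  jacobson_radical R (p%:R)%R ->
  clean_ring (group_ring R G).
Proof.
move=> abR exR p_prime cardG Jp.
apply: (group_ring_clean p_prime cardG) => [r|].
  by rewrite -mulr_natl; apply: jacobson_right_invertible.
exact: abelian_exchange_clean.
Qed.
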